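(* Let $V$ be a vector space over $k$, let $TV$ be its tensor algebra, let $J$ be a (two-sided) ideal in $TV$, and let $C$ be a coalgebra. 1. Suppose that $\sigma:C\to\mathrm{End}(TV)$ measures and that $\sigma(C)(J)\subset J$. Then $\sigma$ induces a measuring map $\tilde\sigma:C\to\mathrm{End}(TV/J)$. 2. If $\hat\mu:C\to\mathrm{Hom}(TV,k)$ measures and $\hat\mu(c)(J)=0$ for all $c\in C$, then $\hat\mu$ descends to a measuring map $C\to\mathrm{Hom}(TV/J,k)$.
   Context: $k$ is $\mathbb{R}$ or $\mathbb{C}$; algebras are associative unital, coalgebras coassociative counital. A linear map $\sigma:C\to \mathrm{Hom}_k(A,B)$ from a coalgebra $C$, with $A,B$ algebras, is a measuring map (''measures'') if $\sigma(c)(aa')=\sum_{(c)}\sigma(c_{(1)})(a)\,\sigma(c_{(2)})(a')$ and $\sigma(c)(1_A)=\epsilon(c)1_B$ for all $c\in C$, $a,a'\in A$. *)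

(* Defs.v *)
From HB Require Import structures.
From mathcomp Require Import all_boot all_order all_algebra.
From mathcomp Require Import generic_quotient ring_quotient sesquilinear.
From mathcomp Require Import boolp reals complex.
From mathcomp Require Import finmap monalg.

Set Implicit Arguments.
Unset Strict Implicit.
Unset Printing Implicit Defensive.

Import GRing.Theory.
Local Open Scope ring_scope.
Local Open Scope quotient_scope.

Reserved Notation "x ⊗ y" (at level 40, left associativity).

Variant real_or_complex (R : realType) : fieldType -> Prop :=
| IsReal : real_or_complex R R
| IsComplex : real_or_complex R R[i].

(* [algType] excludes the zero ring, which occurs here as the quotient of an
   algebra by the improper ideal. *)
HB.mixin Record isPzAlgebra (k : fieldType) A of GRing.Lmodule k A := {
  amul : A -> A -> A;
  aone : A;
  amulA : associative amul;
  amul1 : left_id aone amul;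
  amulr1 : right_id aone amul;
  amulDl : left_distributive amul +%R;
  amulDr : right_distributive amul +%R;
  amulZl : forall a x y, amul (a *: x) y = a *: amul x y;
  amulZr : forall a x y, amul x (a *: y) = a *: amul x y
}.

#[short(type="pzAlgType")]
HB.structure Definition PzAlgebra (k : fieldType) :=
  {A of GRing.Lmodule k A & isPzAlgebra k A}.

#[non_forgetful_inheritance]
HB.instance Definition _ (k : fieldType) (A : pzAlgType k) :=
  GRing.Zmodule_isPzRing.Build (PzAlgebra.sort A)
    (@amulA k A) (@amul1 k A) (@amulr1 k A) (@amulDl k A) (@amulDr k A).

HB.instance Definition _ (k : fieldType) :=
  @isPzAlgebra.Build k k^o *%R 1 (@mulrA k) (@mul1r k) (@mulr1 k)
    (@mulrDl k) (@mulrDr k) (fun a x y => esym (mulrA a x y))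
    (fun a x y => mulrCA x a y).

Section MonoidAlgebra.
Variables (k : fieldType) (M : monomType).

Let malg_scalerAr (a : k) (x y : {malg k[M]}) : x * (a *: y) = a *: (x * y).
Proof.
apply/malgP=> m; rewrite mcoeffZ.
rewrite (mcoeffMlw m (fsubset_refl (msupp x)) (msuppZ_le a y)) mcoeffMl.
rewrite mulr_sumr; apply: eq_bigr => i _.
rewrite mulr_sumr; apply: eq_bigr => j _.
by rewrite mcoeffZ mulrnAr mulrCA.
Qed.

HB.instance Definition _ := @isPzAlgebra.Build k (malg M k) *%R 1
  (@mulrA _) (@mul1r _) (@mulr1 _) (@mulrDl _) (@mulrDr _)
  (fun a x y => esym (scalerAl a x y)) malg_scalerAr.
End MonoidAlgebra.

(* Membership is boolean, but by [boolp.asbool] every [Prop]-valued subset is of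
   this form, so no decidability is being assumed. *)
HB.mixin Record isMulIdeal (k : fieldType) (A : pzAlgType k) (S : {pred A}) := {
  idealMl : forall a x, x \in S -> a * x \in S;
  idealMr : forall x a, x \in S -> x * a \in S
}.

#[short(type="twoSidedIdeal")]
HB.structure Definition TwoSidedIdeal (k : fieldType) (A : pzAlgType k) :=
  {S of @GRing.SubmodClosed k A S & isMulIdeal k A S}.

Section Span.
Variables (k : fieldType) (V : lmodType k) (G : V -> Prop).

Definition span_pred : {pred V} := fun x =>
  `[< forall N : submodClosed V, (forall y, G y -> y \in N) -> x \in N >].

Let span_submod : submod_closed span_pred.
Proof.
split=> [|a x y]; first by apply/asboolP=> N _; apply: rpred0.
move=> /asboolP Gx /asboolP Gy; apply/asboolP=> N GN.
by rewrite rpredD ?rpredZ ?Gx ?Gy.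
Qed.

HB.instance Definition _ := GRing.isSubmodClosed.Build k V span_pred span_submod.

Definition span : submodClosed V := span_pred.

Lemma mem_span x : G x -> x \in span.
Proof. by move=> Gx; apply/asboolP=> N; apply. Qed.

Lemma span_min (N : submodClosed V) x :
  (forall y, G y -> y \in N) -> x \in span -> x \in N.
Proof. by move=> GN /asboolP; apply. Qed.
End Span.

Section IdealGen.
Variables (k : fieldType) (A : pzAlgType k) (G : A -> Prop).

Definition ideal_gen_pred : {pred A} := fun x =>
  `[< forall J : twoSidedIdeal A, (forall y, G y -> y \in J) -> x \in J >].

Let ideal_gen_submod : submod_closed ideal_gen_pred.
Proof.
split=> [|a x y]; first by apply/asboolP=> J _; apply: rpred0.
move=> /asboolP Gx /asboolP Gy; apply/asboolP=> J GJ.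
by rewrite rpredD ?rpredZ ?Gx ?Gy.
Qed.

Let ideal_gen_mull a x : x \in ideal_gen_pred -> a * x \in ideal_gen_pred.
Proof.
by move=> /asboolP Gx; apply/asboolP=> J GJ; rewrite idealMl ?Gx.
Qed.

Let ideal_gen_mulr x a : x \in ideal_gen_pred -> x * a \in ideal_gen_pred.
Proof.
by move=> /asboolP Gx; apply/asboolP=> J GJ; rewrite idealMr ?Gx.
Qed.

HB.instance Definition _ :=
  GRing.isSubmodClosed.Build k A ideal_gen_pred ideal_gen_submod.
HB.instance Definition _ :=
  isMulIdeal.Build k A ideal_gen_pred ideal_gen_mull ideal_gen_mulr.

Definition ideal_gen : twoSidedIdeal A := ideal_gen_pred.

Lemma mem_ideal_gen x : G x -> x \in ideal_gen.
Proof. by move=> Gx; apply/asboolP=> J; apply. Qed.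

Lemma ideal_gen_min (J : twoSidedIdeal A) x :
  (forall y, G y -> y \in J) -> x \in ideal_gen -> x \in J.
Proof. by move=> GJ /asboolP; apply. Qed.
End IdealGen.

Section Quotient.
Variables (k : fieldType) (V : lmodType k) (N : submodClosed V).

Definition submod_pred : {pred V} := N.
HB.instance Definition _ := GRing.isZmodClosed.Build V submod_pred
  (GRing.submod_closedB (GRing.submodClosedP N)).
Definition submod_zmod : zmodClosed V := submod_pred.

Definition quotmod : Type := Quotient.quot submod_zmod.
HB.instance Definition _ := GRing.Zmodule.on quotmod.
End Quotient.

HB.lock Definition qproj (k : fieldType) (V : lmodType k) (N : submodClosed V)
  (x : V) : quotmod N := \pi_(Quotient.quot (submod_zmod N)) x.

HB.lock Definition qrepr (k : fieldType) (V : lmodType k) (N : submodClosed V)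
  (u : quotmod N) : V := repr (u : Quotient.quot (submod_zmod N)).

Section QuotientModule.
Variables (k : fieldType) (V : lmodType k) (N : submodClosed V).
Local Notation quotmod := (quotmod N).
Local Notation qproj := (@qproj k V N).
Local Notation qrepr := (@qrepr k V N).

Lemma qreprK : cancel qrepr qproj.
Proof. by move=> u; rewrite qproj.unlock qrepr.unlock reprK. Qed.

Lemma qproj_eq x y : qproj x = qproj y <-> x - y \in N.
Proof.
rewrite qproj.unlock -[x - y \in N]/(x - y \in submod_zmod N) Quotient.idealrBE.
by split=> [|/eqP] //; move=> /eqP.
Qed.

Let qprojB : zmod_morphism qproj.
Proof. by move=> x y; rewrite qproj.unlock raddfB. Qed.
HB.instance Definition _ := GRing.isZmodMorphism.Build V quotmod qproj qprojB.

Definition qscale (a : k) (u : quotmod) : quotmod := qproj (a *: qrepr u).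

Lemma qscaleE a x : qscale a (qproj x) = qproj (a *: x).
Proof.
by apply/qproj_eq; rewrite -scalerBr rpredZ //; apply/qproj_eq; rewrite qreprK.
Qed.

Let qscaleA a b u : qscale a (qscale b u) = qscale (a * b) u.
Proof. by rewrite -[u]qreprK !qscaleE scalerA. Qed.
Let qscale1 : left_id 1 qscale.
Proof. by move=> u; rewrite -[u]qreprK qscaleE scale1r. Qed.
Let qscaleDr : right_distributive qscale +%R.
Proof.
by move=> a u v; rewrite -[u]qreprK -[v]qreprK -raddfD !qscaleE -raddfD -scalerDr.
Qed.
Let qscaleDl u : {morph qscale^~ u : a b / a + b}.
Proof.
by move=> a b; rewrite -[u]qreprK !qscaleE -raddfD -scalerDl.
Qed.
HB.instance Definition _ := GRing.Zmodule_isLmodule.Build k quotmod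
  qscaleA qscale1 qscaleDr qscaleDl.

Let qproj_scalable : scalable qproj.
Proof. by move=> a x; rewrite -[RHS]/(qscale a _) qscaleE. Qed.
HB.instance Definition _ :=
  GRing.isScalable.Build k V quotmod *:%R qproj qproj_scalable.
End QuotientModule.

Section QuotientAlgebra.
Variables (k : fieldType) (A : pzAlgType k) (J : twoSidedIdeal A).

Definition quotalg : Type := quotmod J.
HB.instance Definition _ := GRing.Lmodule.on quotalg.

Definition qmul (u v : quotalg) : quotalg := qproj J (qrepr u * qrepr v).

Lemma qmulE x y : qmul (qproj J x) (qproj J y) = qproj J (x * y).
Proof.
apply/qproj_eq; set x' := qrepr _; set y' := qrepr _.
have Jx : x' - x \in J by apply/qproj_eq; rewrite qreprK.
have Jy : y' - y \in J by apply/qproj_eq; rewrite qreprK.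
rewrite -[x' * y'](addrNK (x * y')) -addrA -mulrBl -mulrBr.
by apply: rpredD; [apply: idealMr | apply: idealMl].
Qed.

Let qmulA : associative qmul.
Proof.
by move=> u v w; rewrite -[u]qreprK -[v]qreprK -[w]qreprK !qmulE mulrA.
Qed.
Let qmul1 : left_id (qproj J 1) qmul.
Proof. by move=> u; rewrite -[u]qreprK qmulE mul1r. Qed.
Let qmulr1 : right_id (qproj J 1) qmul.
Proof. by move=> u; rewrite -[u]qreprK qmulE mulr1. Qed.
Let qmulDl : left_distributive qmul +%R.
Proof.
move=> u v w; rewrite -[u]qreprK -[v]qreprK -[w]qreprK.
by rewrite -raddfD !qmulE -raddfD mulrDl.
Qed.
Let qmulDr : right_distributive qmul +%R.
Proof.
move=> u v w; rewrite -[u]qreprK -[v]qreprK -[w]qreprK.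
by rewrite -raddfD !qmulE -raddfD mulrDr.
Qed.
Let qmulZl a u v : qmul (a *: u) v = a *: qmul u v.
Proof.
by rewrite -[u]qreprK -[v]qreprK -linearZ !qmulE -linearZ; congr qproj; apply: amulZl.
Qed.
Let qmulZr a u v : qmul u (a *: v) = a *: qmul u v.
Proof.
by rewrite -[u]qreprK -[v]qreprK -linearZ !qmulE -linearZ; congr qproj; apply: amulZr.
Qed.
HB.instance Definition _ := isPzAlgebra.Build k quotalg
  qmulA qmul1 qmulr1 qmulDl qmulDr qmulZl qmulZr.
HB.instance Definition _ :=
  GRing.PzRing.copy quotalg (PzAlgebra.sort (quotalg : pzAlgType k)).

Definition aproj : A -> quotalg := qproj J.
HB.instance Definition _ := GRing.Linear.on aproj.

Lemma aproj_monoid_morphism : monoid_morphism aproj.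
Proof. by split=> // x y; rewrite [RHS]qmulE. Qed.

Lemma aproj_eq x y : aproj x = aproj y <-> x - y \in J.
Proof. exact: qproj_eq. Qed.

Lemma aproj_surj (u : quotalg) : exists x, u = aproj x.
Proof. by exists (qrepr u); rewrite /aproj qreprK. Qed.
End QuotientAlgebra.

Section Hom.
Variables (k : fieldType) (U W : lmodType k).

Lemma linear_ext (f g : {linear U -> W}) : f =1 g -> f = g.
Proof.
case: f g => [f [[fD] [fZ]]] [g [[gD] [gZ]]] /= /funext fg; subst g.
by rewrite (Prop_irrelevance fD gD) (Prop_irrelevance fZ gZ).
Qed.

HB.instance Definition _ := gen_eqMixin {linear U -> W}.
HB.instance Definition _ := gen_choiceMixin {linear U -> W}.

Let hom0 : {linear U -> W} := \0.
Let homN (f : {linear U -> W}) : {linear U -> W} := \- f.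
Let homD (f g : {linear U -> W}) : {linear U -> W} := f \+ g.
Let homZ (a : k) (f : {linear U -> W}) : {linear U -> W} := a \*: f.

Let homDA : associative homD.
Proof. by move=> f g h; apply: linear_ext => x /=; rewrite addrA. Qed.
Let homDC : commutative homD.
Proof. by move=> f g; apply: linear_ext => x /=; rewrite addrC. Qed.
Let hom0D : left_id hom0 homD.
Proof. by move=> f; apply: linear_ext => x /=; rewrite add0r. Qed.
Let homND : left_inverse hom0 homN homD.
Proof. by move=> f; apply: linear_ext => x /=; rewrite addNr. Qed.
HB.instance Definition _ :=
  GRing.isZmodule.Build {linear U -> W} homDA homDC hom0D homND.

Let homZA a b f : homZ a (homZ b f) = homZ (a * b) f.
Proof. by apply: linear_ext => x /=; rewrite scalerA. Qed.
Let hom1Z : left_id 1 homZ.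
Proof. by move=> f; apply: linear_ext => x /=; rewrite scale1r. Qed.
Let homZDr : right_distributive homZ +%R.
Proof. by move=> a f g; apply: linear_ext => x /=; rewrite scalerDr. Qed.
Let homZDl f : {morph homZ^~ f : a b / a + b}.
Proof. by move=> a b; apply: linear_ext => x /=; rewrite scalerDl. Qed.
HB.instance Definition _ :=
  GRing.Zmodule_isLmodule.Build k {linear U -> W} homZA hom1Z homZDr homZDl.

Lemma homDE (f g : {linear U -> W}) x : (f + g) x = f x + g x.
Proof. by []. Qed.

Lemma homZE a (f : {linear U -> W}) x : (a *: f) x = a *: f x.
Proof. by []. Qed.
End Hom.

HB.lock Definition malg_lift (k : fieldType) (X : choiceType) (W : lmodType k)
  (f : X -> W) (g : {malg k[X]}) : W := \sum_(x <- msupp g) g@_x *: f x.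

Section FreeModule.
Variables (k : fieldType) (X : choiceType) (W : lmodType k).
Variable f : X -> W.

Let malg_liftEw (d : {fset X}) (g : {malg k[X]}) :
  fsubset (msupp g) d -> malg_lift f g = \sum_(x <- d) g@_x *: f x.
Proof.
move=> gd; rewrite malg_lift.unlock (big_fset_incl _ gd) // => x _ /mcoeff_outdom ->.
by rewrite scale0r.
Qed.

Let malg_lift_linear : linear (malg_lift f).
Proof.
move=> a g h; pose d := (msupp g `|` msupp h)%fset.
have gd : fsubset (msupp g) d by apply: fsubsetUl.
have hd : fsubset (msupp h) d by apply: fsubsetUr.
rewrite (malg_liftEw gd) (malg_liftEw hd) (@malg_liftEw d).
  rewrite scaler_sumr -big_split /=; apply: eq_bigr => x _.
  by rewrite mcoeffD mcoeffZ scalerDl scalerA.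
apply: fsubset_trans (msuppD_le _ _) _; rewrite fsubUset hd andbT.
exact: fsubset_trans (msuppZ_le _ _) gd.
Qed.
HB.instance Definition _ :=
  GRing.isLinear.Build k {malg k[X]} W *:%R (malg_lift f) malg_lift_linear.

Lemma malg_liftU x : malg_lift f << x >> = f x.
Proof. by rewrite malg_lift.unlock msuppU oner_eq0 big_seq_fset1 mcoeffUU scale1r. Qed.

Lemma malgUZ c x : << c *g x >> = c *: << x >> :> {malg k[X]}.
Proof. by apply/malgP=> y; rewrite mcoeffZ !mcoeffU mulrnAr mulr1. Qed.

Lemma malg_linear_ext (p q : {linear {malg k[X]} -> W}) :
  (forall x, p << x >> = q << x >>) -> p =1 q.
Proof.
move=> pq g; rewrite [g]monalgE !linear_sum; apply: eq_bigr => x _.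
by rewrite malgUZ !linearZ /= pq.
Qed.
End FreeModule.

(* [U ⊗ W] is the free module on the pairs modulo bilinearity; its universal
   property is [tensor_lift], [tensor_lift_pure] and [tensor_ext]. *)
Section Tensor.
Variables (k : fieldType) (U W : lmodType k).

Variant tensor_relation : {malg k[(U * W)%type]} -> Prop :=
| TensorLinearl a x y z :
    tensor_relation (<< (a *: x + y, z) >> - (a *: << (x, z) >> + << (y, z) >>))
| TensorLinearr a x y z :
    tensor_relation (<< (x, a *: y + z) >> - (a *: << (x, y) >> + << (x, z) >>)).

Definition tensor : Type := quotmod (span tensor_relation).
HB.instance Definition _ := GRing.Lmodule.on tensor.
End Tensor.

HB.lock Definition pure_tensor (k : fieldType) (U W : lmodType k)
  (x : U) (y : W) : tensor U W := qproj _ << (x, y) >>.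

HB.lock Definition tensor_lift (k : fieldType) (U W Z : lmodType k)
  (f : {bilinear U -> W -> Z}) (t : tensor U W) : Z :=
  malg_lift (fun p => f p.1 p.2) (qrepr t).

Section TensorProduct.
Variables (k : fieldType) (U W : lmodType k).
Local Notation tensor := (tensor U W).
Local Notation tensor_relation := (@tensor_relation k U W).
Local Notation pure_tensor := (@pure_tensor k U W).

Let pure_tensor_bilinear :
  bilinear_for *:%R *:%R pure_tensor.
Proof.
split=> [z a x y | x a y z]; rewrite pure_tensor.unlock -linearP /=.
  by apply/qproj_eq/mem_span; apply: TensorLinearl.
by apply/qproj_eq/mem_span; apply: TensorLinearr.
Qed.
HB.instance Definition _ := bilinear_isBilinear.Build k U W tensor *:%R *:%R
  pure_tensor pure_tensor_bilinear.

Section Lift.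
Variables (Z : lmodType k) (f : {bilinear U -> W -> Z}).

Local Notation tensor_lift := (@tensor_lift k U W Z f).

Let kerf : {pred {malg k[(U * W)%type]}} :=
  fun g => malg_lift (fun p => f p.1 p.2) g == 0.
Let kerf_submod : submod_closed kerf.
Proof.
split=> [|a g h]; rewrite !unfold_in ?linear0 // linearP /=.
by move=> /eqP-> /eqP->; rewrite scaler0 addr0.
Qed.
HB.instance Definition _ :=
  GRing.isSubmodClosed.Build k {malg k[(U * W)%type]} kerf kerf_submod.

Let tensor_liftE g :
  tensor_lift (qproj _ g) = malg_lift (fun p => f p.1 p.2) g.
Proof.
apply/eqP; rewrite tensor_lift.unlock -subr_eq0 -linearB.
apply: (@span_min _ _ tensor_relation kerf) => [h|]; last first.
  by apply/qproj_eq; rewrite qreprK.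
case=> [a x y z | a x y z]; rewrite unfold_in linearB linearP /= !malg_liftU /=.
  by rewrite linearPl subrr.
by rewrite linearPr subrr.
Qed.

Let tensor_lift_linear : linear tensor_lift.
Proof.
move=> a u v; rewrite -[u]qreprK -[v]qreprK -linearP !tensor_liftE.
exact: linearP.
Qed.
HB.instance Definition _ :=
  GRing.isLinear.Build k tensor Z *:%R tensor_lift tensor_lift_linear.

Lemma tensor_lift_pure x y : tensor_lift (pure_tensor x y) = f x y.
Proof. by rewrite pure_tensor.unlock tensor_liftE malg_liftU. Qed.
End Lift.

Lemma tensor_ext (Z : lmodType k) (p q : {linear tensor -> Z}) :
  (forall x y, p (pure_tensor x y) = q (pure_tensor x y)) -> p =1 q.
Proof.
move=> pq t; rewrite -[t]qreprK.
apply: (malg_linear_ext (p := p \o qproj _) (q := q \o qproj _)) => -[x y] /=.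
by have := pq x y; rewrite pure_tensor.unlock.
Qed.
End TensorProduct.

Notation "x ⊗ y" := (pure_tensor x y) : ring_scope.

Section TensorMaps.
Variable k : fieldType.

Section Map.
Variables (U U' W W' : lmodType k).
Variables (f : {linear U -> U'}) (g : {linear W -> W'}).

Definition pure_map (x : U) (y : W) : tensor U' W' := f x ⊗ g y.

Let pure_map_bilinear : bilinear_for *:%R *:%R pure_map.
Proof.
by split=> [z a x y | x a y z]; rewrite /pure_map linearP (linearPl, linearPr).
Qed.
HB.instance Definition _ := bilinear_isBilinear.Build k U W (tensor U' W')
  *:%R *:%R pure_map pure_map_bilinear.

Definition tensor_map : {linear tensor U W -> tensor U' W'} := tensor_lift pure_map.
End Map.

Section Associator.
Variables (U V W : lmodType k).

Definition pure_assoc (z : W) (x : U) (y : V) : tensor U (tensor V W) := x ⊗ (y ⊗ z).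

Let pure_assoc_bilinear z : bilinear_for *:%R *:%R (pure_assoc z).
Proof.
split=> [y a x x' | x a y y']; rewrite /pure_assoc; first by rewrite linearPl.
by rewrite [(a *: y + y') ⊗ z]linearPl linearPr.
Qed.
HB.instance Definition _ z := bilinear_isBilinear.Build k U V (tensor U (tensor V W))
  *:%R *:%R (pure_assoc z) (pure_assoc_bilinear z).

Definition assoc_fun (t : tensor U V) (z : W) : tensor U (tensor V W) :=
  tensor_lift (pure_assoc z) t.

Let assoc_fun_bilinear : bilinear_for *:%R *:%R assoc_fun.
Proof.
split=> [z a t t' | t a z z']; first exact: linearP.
pose h : {linear tensor U V -> tensor U (tensor V W)} :=
  a \*: tensor_lift (pure_assoc z) \+ tensor_lift (pure_assoc z').
pose p : {linear tensor U V -> tensor U (tensor V W)} :=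
  tensor_lift (pure_assoc (a *: z + z')).
rewrite -[LHS]/(p t) -[RHS]/(h t); apply: tensor_ext => x y {t}.
rewrite /p /h /= !tensor_lift_pure /= /pure_assoc.
by rewrite [y ⊗ (a *: z + z')]linearPr linearPr.
Qed.
HB.instance Definition _ := bilinear_isBilinear.Build k (tensor U V) W
  (tensor U (tensor V W)) *:%R *:%R assoc_fun assoc_fun_bilinear.

Definition tensor_assoc : {linear tensor (tensor U V) W -> tensor U (tensor V W)} :=
  tensor_lift assoc_fun.

Lemma tensor_assoc_pure x y z : tensor_assoc (x ⊗ y ⊗ z) = x ⊗ (y ⊗ z).
Proof.
by rewrite /tensor_assoc /= tensor_lift_pure /= /assoc_fun tensor_lift_pure.
Qed.
End Associator.

Section Contraction.
Variables (U : lmodType k) (e : {scalar U}).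

Definition scalel_fun (x y : U) : U := e x *: y.
Definition scaler_fun (x y : U) : U := e y *: x.

Let scalel_fun_bilinear : bilinear_for *:%R *:%R scalel_fun.
Proof.
split=> [z a x y | x a y z]; rewrite /scalel_fun.
  by rewrite linearP scalerDl /= scalerA.
by rewrite scalerDr /= !scalerA mulrC.
Qed.
HB.instance Definition _ := bilinear_isBilinear.Build k U U U
  *:%R *:%R scalel_fun scalel_fun_bilinear.

Let scaler_fun_bilinear : bilinear_for *:%R *:%R scaler_fun.
Proof.
split=> [z a x y | x a y z]; rewrite /scaler_fun.
  by rewrite scalerDr /= !scalerA mulrC.
by rewrite linearP scalerDl /= scalerA.
Qed.
HB.instance Definition _ := bilinear_isBilinear.Build k U U U
  *:%R *:%R scaler_fun scaler_fun_bilinear.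

(* The maps [e ⊗ id] and [id ⊗ e] followed by the canonical isomorphisms of
   [k ⊗ U] and [U ⊗ k] with [U]. *)
Definition contractl : {linear tensor U U -> U} := tensor_lift scalel_fun.
Definition contractr : {linear tensor U U -> U} := tensor_lift scaler_fun.
End Contraction.
End TensorMaps.
Arguments tensor_assoc {k U V W}.

HB.mixin Record isCoalgebra (k : fieldType) C of GRing.Lmodule k C := {
  coprod : {linear C -> tensor C C};
  counit : {scalar C};
  coprodA : forall c : C, tensor_assoc (tensor_map coprod idfun (coprod c)) =
                          tensor_map idfun coprod (coprod c);
  counitl : forall c : C, contractl counit (coprod c) = c;
  counitr : forall c : C, contractr counit (coprod c) = c
}.

#[short(type="coalgType")]
HB.structure Definition Coalgebra (k : fieldType) :=
  {C of GRing.Lmodule k C & isCoalgebra k C}.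

Section Measuring.
Variables (k : fieldType) (C : coalgType k) (A B : pzAlgType k).
Implicit Type sigma : {linear C -> {linear A -> B}}.

Definition measuring_fun sigma (a a' : A) (c1 c2 : C) : B :=
  sigma c1 a * sigma c2 a'.

Let measuring_fun_bilinear sigma a a' :
  bilinear_for *:%R *:%R (measuring_fun sigma a a').
Proof.
split=> [c x y d | x c y d]; rewrite /measuring_fun linearP /=.
  by rewrite mulrDl; congr (_ + _); apply: amulZl.
by rewrite mulrDr; congr (_ + _); apply: amulZr.
Qed.
HB.instance Definition _ sigma a a' := bilinear_isBilinear.Build k C C B
  *:%R *:%R (measuring_fun sigma a a') (measuring_fun_bilinear sigma a a').

(* [tensor_lift f (coprod c)] is the Sweedler sum of the [f c_(1) c_(2)]. *)
Definition measures sigma : Prop :=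
  (forall c a a',
     sigma c (a * a') = tensor_lift (measuring_fun sigma a a') (coprod c)) /\
  (forall c, sigma c 1 = counit c *: (1 : B)).
End Measuring.

(* The tensor algebra is the free associative algebra on the underlying set of
   [V], modulo linearity of the generators; its universal property is
   [tensor_algebra_liftP], [tensor_algebra_lift_inj], [tensor_algebra_lift_uniq]. *)
Section TensorAlgebra.
Variables (k : fieldType) (V : lmodType k).

Notation free_algebra := {malg k[{fmonom V}]}.

Definition letter (v : V) : free_algebra := << fmu v >>.

Variant tensor_algebra_relation : free_algebra -> Prop :=
| LetterLinear a u v :
    tensor_algebra_relation (letter (a *: u + v) - (a *: letter u + letter v)).

Definition tensor_algebra : Type := quotalg (ideal_gen tensor_algebra_relation).
HB.instance Definition _ := PzAlgebra.on tensor_algebra.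
HB.instance Definition _ := GRing.PzRing.on tensor_algebra.

Definition tensor_inj (v : V) : tensor_algebra := aproj _ (letter v).

Let tensor_inj_linear : linear tensor_inj.
Proof.
move=> a u v; rewrite /tensor_inj -linearP.
by apply/aproj_eq/mem_ideal_gen; apply: LetterLinear.
Qed.
HB.instance Definition _ := GRing.isLinear.Build k V tensor_algebra *:%R
  tensor_inj tensor_inj_linear.

Section UniversalProperty.
Variables (A : pzAlgType k) (f : {linear V -> A}).

Definition word_lift (w : {fmonom V}) : A := \prod_(v <- w) f v.

Definition free_lift : {linear free_algebra -> A} := malg_lift word_lift.

Let free_liftU c w : free_lift << c *g w >> = c *: word_lift w.
Proof. by rewrite malgUZ linearZ /= malg_liftU. Qed.

Let free_lift1 : free_lift 1 = 1.
Proof. by rewrite /= malg_liftU /word_lift fm1 big_nil. Qed.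

Let free_liftM g h : free_lift (g * h) = free_lift g * free_lift h.
Proof.
have E x : free_lift x = \sum_(v <- msupp x) x@_v *: word_lift v.
  by rewrite /free_lift /= malg_lift.unlock.
rewrite malgME linear_sum (E g) mulr_suml; apply: eq_bigr => v _.
rewrite linear_sum (E h) mulr_sumr; apply: eq_bigr => w _.
rewrite free_liftU /word_lift fmM big_cat /= -scalerA.
by rewrite [RHS]amulZl; congr (_ *: _); rewrite [RHS]amulZr.
Qed.

Let kerf : {pred free_algebra} := fun g => free_lift g == 0.
Let kerf_submod : submod_closed kerf.
Proof.
split=> [|a g h]; rewrite !unfold_in ?linear0 // linearP /=.
by move=> /eqP-> /eqP->; rewrite scaler0 addr0.
Qed.
Let kerf_mull (g h : free_algebra) : h \in kerf -> g * h \in kerf.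
Proof. by rewrite !unfold_in free_liftM => /eqP->; rewrite mulr0. Qed.
Let kerf_mulr (g h : free_algebra) : g \in kerf -> g * h \in kerf.
Proof. by rewrite !unfold_in free_liftM => /eqP->; rewrite mul0r. Qed.
HB.instance Definition _ :=
  GRing.isSubmodClosed.Build k free_algebra kerf kerf_submod.
HB.instance Definition _ :=
  isMulIdeal.Build k free_algebra kerf kerf_mull kerf_mulr.

Definition tensor_algebra_lift (t : tensor_algebra) : A := free_lift (qrepr t).

Let liftE g : tensor_algebra_lift (aproj _ g) = free_lift g.
Proof.
apply/eqP; rewrite -subr_eq0 -linearB.
apply: (@ideal_gen_min _ _ tensor_algebra_relation kerf) => [h|]; last first.
  by apply/qproj_eq; rewrite qreprK.
case=> a u v; rewrite unfold_in /letter linearB linearP !free_liftU.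
by rewrite !scale1r /word_lift !fmU !big_seq1 linearP subrr.
Qed.

Let lift_linear : linear tensor_algebra_lift.
Proof.
move=> a t u; have [g ->] := aproj_surj t; have [h ->] := aproj_surj u.
by rewrite -linearP !liftE linearP.
Qed.
HB.instance Definition _ := GRing.isLinear.Build k tensor_algebra A *:%R
  tensor_algebra_lift lift_linear.

Lemma tensor_algebra_liftP : monoid_morphism tensor_algebra_lift.
Proof.
split=> [|t u]; first by rewrite [LHS]liftE free_lift1.
have [g ->] := aproj_surj t; have [h ->] := aproj_surj u.
by rewrite -(aproj_monoid_morphism _).2 !liftE free_liftM.
Qed.

Lemma tensor_algebra_lift_inj v : tensor_algebra_lift (tensor_inj v) = f v.
Proof. by rewrite liftE free_liftU scale1r /word_lift fmU big_seq1. Qed.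

Lemma tensor_algebra_lift_uniq (F : {linear tensor_algebra -> A}) :
  monoid_morphism F -> (forall v, F (tensor_inj v) = f v) ->
  F =1 tensor_algebra_lift.
Proof.
move=> [F1 FM] Ff t; have [g ->] := aproj_surj t; rewrite liftE.
apply: (malg_linear_ext (p := F \o aproj _) (q := free_lift)) => w /=.
rewrite malg_liftU -[w]fmK; case: w => /=; elim=> [|v s IHs].
  by rewrite -fmoneE /word_lift fm1 big_nil -F1.
have -> : << FMonom (v :: s) >> = letter v * << FMonom s >> :> free_algebra.
  by rewrite /letter [RHS]fgmulUU mulr1; congr mkmalgU; rewrite [RHS]fmmulE fmU.
rewrite (aproj_monoid_morphism _).2 [LHS]FM Ff IHs.
by rewrite /word_lift /= big_cons.
Qed.
End UniversalProperty.
End TensorAlgebra.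

(* Main.v *)
From HB Require Import structures.
Require Import Defs.
From mathcomp Require Import all_boot all_order all_algebra.
From mathcomp Require Import boolp reals complex.

(** Both parts are instances of one statement about arbitrary algebras: let
    [sigma : C -> Hom(A, B)] measure, let [p : B -> B'] be an algebra morphism
    and let [J] be an ideal of [A] such that every [p \o sigma c] kills [J].
    Then [p \o sigma c] factors through [A / J], and the resulting map
    [C -> Hom(A / J, B')] measures.  For the first part [p] is the projection
    [A -> A / J] of [A = B = TV], and the hypothesis [sigma(C)(J) \subset J]
    says exactly that [p \o sigma c] kills [J]; for the second part [p] is the
    identity of [k].

    The measuring identities for the induced map [tau] only need to be checked
    on classes of elements of [A], since the projection is surjective
    ([measures_descent]).  There they are the images under [p] of the identities
    for [sigma]: [p] commutes with the Sweedler sum, because both sides are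
    linear in the coproduct and agree on pure tensors by multiplicativity of [p]
    ([tensor_lift_measuring_fun_morph]).  Surjectivity of the projection also
    gives uniqueness. *)

Set Implicit Arguments.
Unset Strict Implicit.
Unset Printing Implicit Defensive.

Import GRing.Theory.
Local Open Scope ring_scope.

Section LinearDescent.
Variables (k : fieldType) (V W : lmodType k) (N : submodClosed V).
Variables (f : {linear V -> W}) (fN0 : forall x, x \in N -> f x = 0).

(** The proof that [f] kills [N] is an argument so that the linear structure,
    which depends on it, can be attached to this function. *)
Definition quotmod_lift (_ : forall x, x \in N -> f x = 0) (u : quotmod N) : W :=
  f (qrepr u).

Lemma quotmod_lift_proj x : quotmod_lift fN0 (qproj N x) = f x.
Proof.
apply/eqP; rewrite -subr_eq0 /quotmod_lift -linearB; apply/eqP/fN0.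
by apply/qproj_eq; rewrite qreprK.
Qed.

Let quotmod_lift_linear : linear (quotmod_lift fN0).
Proof.
move=> a u v; rewrite -[u]qreprK -[v]qreprK -linearP !quotmod_lift_proj.
exact: linearP.
Qed.
HB.instance Definition _ := GRing.isLinear.Build k (quotmod N) W *:%R
  (quotmod_lift fN0) quotmod_lift_linear.
End LinearDescent.

Section MeasuringDescent.
Variables (k : fieldType) (C : coalgType k) (A B B' : pzAlgType k).
Variables (J : twoSidedIdeal A) (p : {linear B -> B'}).
Hypothesis pM : monoid_morphism p.
Variable sigma : {linear C -> {linear A -> B}}.

(** An algebra morphism commutes with Sweedler sums of products; by linearity
    in the coproduct, this is multiplicativity of [p] on each summand. *)
Lemma tensor_lift_measuring_fun_morph (A' : pzAlgType k)
    (tau : {linear C -> {linear A' -> B'}}) (a a' : A) (b b' : A') t :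
  (forall c, tau c b = p (sigma c a)) ->
  (forall c, tau c b' = p (sigma c a')) ->
  tensor_lift (measuring_fun tau b b') t =
    p (tensor_lift (measuring_fun sigma a a') t).
Proof.
move=> taub taub'.
apply: (tensor_ext (p := tensor_lift (measuring_fun tau b b'))
  (q := p \o tensor_lift (measuring_fun sigma a a'))) => c d /=.
by rewrite !tensor_lift_pure /= /measuring_fun taub taub' pM.2.
Qed.

(** Every element of [A / J] is a class, so the measuring identities of [tau]
    are those of [sigma] pushed forward along [p]. *)
Lemma measures_descent (tau : {linear C -> {linear quotalg J -> B'}}) :
  (forall c x, tau c (aproj J x) = p (sigma c x)) ->
  measures sigma -> measures tau.
Proof.
move=> tauE [sigmaM sigma1]; split=> [c u u'|c].
  have [x ->] := aproj_surj u; have [x' ->] := aproj_surj u'.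
  rewrite -(aproj_monoid_morphism J).2 tauE sigmaM.
  by rewrite (@tensor_lift_measuring_fun_morph _ _ x x').
by rewrite -(aproj_monoid_morphism J).1 tauE sigma1 linearZ pM.1.
Qed.

Hypothesis psigmaJ0 : forall c x, x \in J -> p (sigma c x) = 0.

Definition measuring_quot (c : C) : {linear quotalg J -> B'} :=
  quotmod_lift (f := p \o sigma c) (psigmaJ0 c).

Lemma measuring_quot_proj c x : measuring_quot c (aproj J x) = p (sigma c x).
Proof. exact: quotmod_lift_proj. Qed.

Let measuring_quot_linear : linear measuring_quot.
Proof.
move=> a c d; apply: linear_ext => u; have [x ->] := aproj_surj u.
by rewrite homDE homZE !measuring_quot_proj !linearP.
Qed.
HB.instance Definition _ := GRing.isLinear.Build k C {linear quotalg J -> B'}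
  *:%R measuring_quot measuring_quot_linear.

Lemma measuring_descent :
  measures sigma ->
  exists! tau : {linear C -> {linear quotalg J -> B'}},
    (forall c x, tau c (aproj J x) = p (sigma c x)) /\ measures tau.
Proof.
move=> msigma; exists measuring_quot; split=> [|tau [tauE _]].
  split; first exact: measuring_quot_proj.
  by apply: measures_descent msigma; exact: measuring_quot_proj.
apply: linear_ext => c; apply: linear_ext => u; have [x ->] := aproj_surj u.
by rewrite tauE; exact: measuring_quot_proj.
Qed.
End MeasuringDescent.

Theorem proposition3p4 (R : realType) (k : fieldType)
    (hk : real_or_complex R k) (V : lmodType k)
    (J : twoSidedIdeal (tensor_algebra V)) (C : coalgType k) :
  (forall sigma : {linear C -> {linear tensor_algebra V -> tensor_algebra V}},
     measures sigma ->
     (forall (c : C) (x : tensor_algebra V), x \in J -> sigma c x \in J) ->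
     exists! tau : {linear C -> {linear quotalg J -> quotalg J}},
       (forall (c : C) (x : tensor_algebra V),
          tau c (aproj J x) = aproj J (sigma c x)) /\
       measures tau) /\
  (forall mu : {linear C -> {linear tensor_algebra V -> k^o}},
     measures mu ->
     (forall (c : C) (x : tensor_algebra V), x \in J -> mu c x = 0) ->
     exists! nu : {linear C -> {linear quotalg J -> k^o}},
       (forall (c : C) (x : tensor_algebra V),
          nu c (aproj J x) = mu c x) /\
       measures nu).
Proof.
split=> [sigma msigma sigmaJ | mu mmu muJ0].
  apply: (measuring_descent (aproj_monoid_morphism J) _ msigma) => c x Jx.
  by rewrite -(linear0 (aproj J)); apply/aproj_eq; rewrite subr0 sigmaJ.
have id_morph : monoid_morphism (idfun : {linear k^o -> k^o}) by [].
exact: (measuring_descent id_morph muJ0 mmu).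
Qed.
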